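(* Let $p$ be a prime and let $(A,+,\cdot)$ be a nilpotent pre-Lie algebra over $\mathbb{F}_p$ with $(A,+)\cong C_p^5$, generated by four elements $x,y,z,u$ (and by no fewer elements) as a pre-Lie algebra. Then the following hold. (1) $A^{[2]}\neq 0$ and $A^{[3]}=0$. (2) $\{x,y,z,u,v\}$ is a basis of the $\mathbb{F}_p$-vector space $A$, where $v$ is a non-zero element of $S''=\{i\cdot j : i,j\in\{x,y,z,u\}\}$. (3) For $i,j\in\{x,y,z,u\}$ one has $i\cdot j=\alpha_{ij}v$ with $\alpha_{ij}\in\mathbb{F}_p$, where not all $\alpha_{ij}$ are zero.
   Context: A pre-Lie algebra over $\mathbb{F}_p$ is an $\mathbb{F}_p$-vector space $A$ with a bilinear product $\cdot$ satisfying $(a\cdot b)\cdot c-a\cdot(b\cdot c)=(b\cdot a)\cdot c-b\cdot(a\cdot c)$ for all $a,b,c\in A$. It is nilpotent if for some $n\in\mathbb{N}$ every product of $n$ elements (in any bracketing) is zero. For subspaces $B,C\subseteq A$, $B\cdot C$ denotes the subspace spanned by all $b\cdot c$ with $b\in B$, $c\in C$. Define $A^{[1]}=A$ and $A^{[i+1]}=\sum_{j=1}^{i}A^{[j]}\cdot A^{[i+1-j]}$ for $i\ge 1$. *)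

(* Defs.v *)
From mathcomp Require Import all_boot all_order all_algebra.

Set Implicit Arguments.
Unset Strict Implicit.
Unset Printing Implicit Defensive.

Import GRing.Theory.
Local Open Scope ring_scope.

(* A pre-Lie algebra is a vector space A together with a bilinear product mul
   satisfying [pre_lie mul]. *)
Section PreLie.
Variables (K : fieldType) (A : vectType K) (mul : {bilinear A -> A -> A}).
Implicit Types (B C W : {vspace A}) (n : nat).

Definition pre_lie : Prop := forall a b c : A,
  mul (mul a b) c - mul a (mul b c) = mul (mul b a) c - mul b (mul a c).

(* [product_of n a]: a is a product of n elements of A in some bracketing. *)
Inductive product_of : nat -> A -> Prop :=
| ProductOne a : product_of 1 a
| ProductMul m n a b :
    product_of m a -> product_of n b -> product_of (m + n) (mul a b).

(* There is no product of 0 elements, so n = 0 must be excluded: it would make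
   every algebra nilpotent. *)
Definition nilpotent_alg : Prop :=
  exists2 n, (0 < n)%N & forall a, product_of n a -> a = 0.

Definition subalgebra W : Prop := {in W &, forall a b, mul a b \in W}.

Definition generates (s : seq A) : Prop :=
  forall W, subalgebra W -> {subset s <= W} -> W = fullv.

(* The subspace spanned by all products b . c with b in B and c in C; by
   bilinearity bases suffice, see [prod_vsP]. *)
Definition prod_vs B C : {vspace A} :=
  <<[seq mul b c | b <- vbasis B, c <- vbasis C]>>%VS.

Lemma mem_prod_vs B C : {in B & C, forall b c, mul b c \in prod_vs B C}.
Proof.
move=> b c /coord_vbasis-> /coord_vbasis->.
rewrite linear_sumlz; apply: memv_suml => i _.
rewrite linear_sumr; apply: memv_suml => j _ /=.
rewrite linearZl_LR linearZr_LR !memvZ // memv_span //.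
by apply/allpairsP; exists ((vbasis B)`_i, (vbasis C)`_j); rewrite !memt_nth.
Qed.

Lemma prod_vsP B C W :
  reflect {in B & C, forall b c, mul b c \in W} (prod_vs B C <= W)%VS.
Proof.
apply: (iffP idP) => [sBCW b c Bb Cc | sBCW].
  by rewrite (subvP sBCW) ?mem_prod_vs.
apply/span_subvP=> _ /allpairsP[[b c] /= [Bb Cc ->]].
by rewrite sBCW ?vbasis_mem.
Qed.

(* [dseries_seq n] is the list A^[1], ..., A^[n], so that A^[j] sits at
   position j - 1; the recursion for A^[n] is restated as [dseries1] and
   [dseriesS]. *)
Fixpoint dseries_seq n : seq {vspace A} :=
  if n is m.+1 then
    let s := dseries_seq m in
    rcons s (if m == 0%N then fullv
             else \sum_(1 <= j < m.+1)
                    prod_vs (nth 0%VS s j.-1) (nth 0%VS s (m.+1 - j).-1))%VS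
  else [::].

(* A^[n] for n >= 1; the value at n = 0 is junk. *)
Definition dseries n : {vspace A} := nth 0%VS (dseries_seq n) n.-1.

Lemma size_dseries_seq n : size (dseries_seq n) = n.
Proof. by elim: n => //= n IHn; rewrite size_rcons IHn. Qed.

Lemma nth_dseries_seq n j : (0 < j <= n)%N ->
  nth 0%VS (dseries_seq n) j.-1 = dseries j.
Proof.
elim: n => [|n IHn] /andP[j_gt0]; first by rewrite leqNgt j_gt0.
rewrite leq_eqVlt => /predU1P[-> // | lt_jn] /=.
by rewrite nth_rcons size_dseries_seq prednK // -ltnS lt_jn IHn ?j_gt0.
Qed.

Lemma dseries1 : dseries 1 = fullv.
Proof. by []. Qed.

Lemma dseriesS i : (0 < i)%N ->
  dseries i.+1 =
    (\sum_(1 <= j < i.+1) prod_vs (dseries j) (dseries (i.+1 - j)))%VS.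
Proof.
move=> i_gt0; rewrite {1}/dseries /= nth_rcons size_dseries_seq ltnn eqxx.
rewrite (negPf (lt0n_neq0 i_gt0)); apply: eq_big_nat => j /andP[j_gt0 lt_ji].
rewrite !nth_dseries_seq ?j_gt0 // subn_gt0 lt_ji /=.
by rewrite leq_subLR -addn1 addnC leq_add2r.
Qed.

End PreLie.

(* Main.v *)
Require Import Defs.
From HB Require Import structures.
From mathcomp Require Import all_boot all_order all_algebra.

Import GRing.Theory.
Local Open Scope ring_scope.

(** Write A^k for the k-th term of the descending series. The mechanism is a
    non-associative Frattini argument: in a nilpotent algebra a set generates
    A if and only if it spans A modulo A^2 ([generates_span] and
    [span_generates]). Hence the least number of generators is the codimension
    of A^2, and for a five-dimensional algebra needing four generators it
    follows that dim A^2 <= 1; moreover A^2 is not zero, since otherwise the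
    four generators would span A.

    Nilpotency also excludes A^3 = A^2 when A^2 is not zero
    ([dseries2_stable]), so A^3 is properly contained in a line, hence zero.
    Products in which one factor lies in A^2 therefore vanish, and the line
    A^2 is spanned by the products of generators ([dseries2_gen]). Any non-zero
    such product v spans A^2, and together with the generators it spans A; five
    vectors that span a five-dimensional space form a basis. *)

(** * The descending series of an algebra *)

Section Series.
Set Implicit Arguments.
Unset Strict Implicit.
Variables (K : fieldType) (A : vectType K) (mul : {bilinear A -> A -> A}).
Implicit Types (U W : {vspace A}) (s t : seq A) (a b c : A).

Lemma mem_prod_span s t b c : b \in <<s>>%VS -> c \in <<t>>%VS ->
  mul b c \in <<[seq mul i j | i <- s, j <- t]>>%VS.
Proof.
rewrite -[s]/(val (in_tuple s)) -[t]/(val (in_tuple t)).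
move=> /coord_span-> /coord_span->.
rewrite linear_sumlz; apply: memv_suml => i _.
rewrite linear_sumr; apply: memv_suml => j _ /=.
rewrite linearZl_LR linearZr_LR !memvZ // memv_span //.
by apply/allpairsP; exists (s`_i, t`_j); rewrite !mem_nth.
Qed.

Lemma dseries_mul i j b c : (0 < i)%N -> (0 < j)%N ->
  b \in dseries mul i -> c \in dseries mul j -> mul b c \in dseries mul (i + j).
Proof.
case: i j => // i [// | j] _ _ Bb Cc.
rewrite addnS dseriesS //.
have lt_i : (i < (i.+1 + j))%N by rewrite addSn ltnS leq_addr.
rewrite big_add1 /= big_mkord.
apply: (subvP (sumv_sup (Ordinal lt_i) isT (subvv _))) => /=.
by apply: mem_prod_vs; rewrite // -addnS addKn.
Qed.

Lemma dseries_mull k a c : (0 < k)%N ->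
  c \in dseries mul k -> mul a c \in dseries mul k.+1.
Proof. by move=> k_gt0; apply: (@dseries_mul 1) => //; rewrite memvf. Qed.

Lemma dseries_mulr k a b : (0 < k)%N ->
  b \in dseries mul k -> mul b a \in dseries mul k.+1.
Proof.
by move=> k_gt0 Bb; rewrite -addn1; apply: dseries_mul; rewrite ?memvf.
Qed.

Lemma mem_mul_dseries2 a b : mul a b \in dseries mul 2.
Proof. by apply: dseries_mull; rewrite ?memvf. Qed.

Lemma dseries2P W :
  (forall a b, mul a b \in W) -> (dseries mul 2 <= W)%VS.
Proof. by move=> Wmul; rewrite dseriesS // big_nat1; apply/prod_vsP=> ? *. Qed.

Lemma dseries3P W :
    {in dseries mul 2, forall c a, mul a c \in W /\ mul c a \in W} ->
  (dseries mul 3 <= W)%VS.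
Proof.
move=> Wmul; rewrite dseriesS // big_nat_recl // big_nat1 subv_add /=.
apply/andP; split; apply/prod_vsP=> b c Bb Cc.
  by case: (Wmul c Cc b).
by case: (Wmul b Bb c).
Qed.

Lemma dseries3_sub2 : (dseries mul 3 <= dseries mul 2)%VS.
Proof. by apply: dseries3P => c _ a; rewrite !mem_mul_dseries2. Qed.

(** The products of n elements are not closed under addition, so membership
    in a subspace W is propagated to A^n one factor at a time, each time
    through the preimage of W under multiplication by the other factor. *)
Lemma dseries_product n W : (0 < n)%N ->
  (forall a, product_of mul n a -> a \in W) -> (dseries mul n <= W)%VS.
Proof.
elim/ltn_ind: n W => -[// | [|n]] IHn W _ prodW.
  by apply/subvP=> a _; apply: prodW; constructor.
rewrite dseriesS // big_add1 /= big_mkord; apply/subv_sumP=> j _.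
apply/prod_vsP=> b c Bb Cc.
have preml d b' : mul b' d \in W = (b' \in linfun (applyr mul d) @^-1: W)%VS.
  by rewrite -memv_preim lfunE.
have premr d a : mul a d \in W = (d \in linfun (mul a) @^-1: W)%VS.
  by rewrite -memv_preim lfunE.
rewrite premr; apply: subvP Cc; apply: (IHn) => [||d prod_d].
- by rewrite subSS ltnS leq_subr.
- by rewrite subSS subn_gt0.
rewrite -premr preml; apply: subvP Bb; apply: IHn => // [|a prod_a].
  by rewrite ltnS.
rewrite -preml; apply: prodW.
by rewrite -(subnKC (ltnW (ltn_ord j : (j.+1 < n.+2)%N))); constructor.
Qed.

(** * Generation modulo the square *)

Hypothesis A_nilp : nilpotent_alg mul.

Lemma nilp_dseries : exists2 n, (0 < n)%N & dseries mul n = 0%VS.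
Proof.
have [n n_gt0 n0] := A_nilp; exists n => //; apply/eqP.
by rewrite -subv0; apply: dseries_product => // a /n0->; apply: mem0v.
Qed.

(** A^3 is determined by A^2 through multiplication by A, so a series that
    stays constant from A^2 to A^3 stays constant forever. *)
Lemma dseries2_stable :
  (dseries mul 2 <= dseries mul 3)%VS -> dseries mul 2 = 0%VS.
Proof.
move=> sA23; have [n n_gt0 n0] := nilp_dseries.
apply/eqP; rewrite -subv0 -n0.
case: n n_gt0 {n0} => // n _; elim: n => [|n IHn]; first exact: subvf.
apply: subv_trans sA23 _; apply: dseries3P => c /(subvP IHn) Cc a.
by rewrite dseries_mull ?dseries_mulr.
Qed.

Lemma generates_span s : generates mul s -> (<<s>> + dseries mul 2)%VS = fullv.
Proof.
apply=> [a b _ _ | a s_a].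
  exact: (subvP (addvSr _ _)) (mem_mul_dseries2 _ _).
exact: (subvP (addvSl _ _)) (memv_span s_a).
Qed.

(** Expanding the product of two sums over a decomposition A = U + A^k, all
    terms but the one in U * U have a factor in A^k. *)
Lemma dseries2_expand k U W : (0 < k)%N -> (U + dseries mul k)%VS = fullv ->
  {in U &, forall a b, mul a b \in W} ->
  (dseries mul 2 <= W + dseries mul k.+1)%VS.
Proof.
move=> k_gt0 genA Wmul; apply: dseries2P => a b.
have decA d : d \in (U + dseries mul k)%VS by rewrite genA memvf.
have /memv_addP[a1 Ua1 [a2 Ca2 ->]] := decA a.
have /memv_addP[b1 Ub1 [b2 Cb2 ->]] := decA b.
rewrite linearDl /= [mul a1 _]linearD /= -addrA memv_add ?Wmul //.
by apply: memvD; [apply: dseries_mull | apply: dseries_mulr].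
Qed.

(** If W is a subalgebra and A = W + A^k, then A^2 <= W + A^(k+1), so the
    hypothesis A = W + A^2 improves to A = W + A^(k+1); the error term
    disappears by nilpotency. *)
Lemma span_generates s : (<<s>> + dseries mul 2)%VS = fullv -> generates mul s.
Proof.
move=> genA W algW /span_subvP sW.
have{genA} genA : (W + dseries mul 2)%VS = fullv.
  by apply/eqP; rewrite eqEsubv subvf -genA addvS.
have [n n_gt0 n0] := nilp_dseries.
rewrite -[W]addv0 -n0; case: n n_gt0 {n0} => // n _.
elim: n => [|n IHn]; apply/eqP; rewrite eqEsubv subvf /=.
  by rewrite dseries1 addvSr.
by rewrite -[X in (X <= _)%VS]genA subv_add addvSl (dseries2_expand _ IHn).
Qed.

(** Generators span A modulo A^2, and a factor from A^2 moves a product into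
    A^3. *)
Lemma dseries2_gen s : generates mul s ->
  (dseries mul 2 <= <<[seq mul i j | i <- s, j <- s]>> + dseries mul 3)%VS.
Proof.
move=> /generates_span genA; apply: dseries2_expand genA _ => // a b.
exact: mem_prod_span.
Qed.

(** A basis of a complement of A^2 generates A. *)
Lemma min_generators_dim d :
    (forall s, generates mul s -> (d <= size s)%N) ->
  (d + \dim (dseries mul 2) <= \dim (fullv : {vspace A}))%N.
Proof.
move=> min_d; set A2 := dseries mul 2.
have <- : (\dim A2^C + \dim A2)%N = \dim (fullv : {vspace A}).
  by rewrite dimv_compl subnK ?dimvS ?subvf.
rewrite leq_add2r -(size_tuple (vbasis A2^C)); apply/min_d/span_generates.
by rewrite (span_basis (vbasisP _)) addvC addv_complf.
Qed.

End Series.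

(** * Dimension from the additive group *)

(** Over the prime field every additive map is linear, because scalars are
    sums of ones. *)
Lemma additive_Fp_linear (p : nat) (A B : lmodType 'F_p)
  (f : {additive A -> B}) : scalable f.
Proof. by move=> k a; rewrite -[k]natr_Zp !scaler_nat raddfMn. Qed.

Lemma additive_bij_dim (p n : nat) (A : vectType 'F_p)
    (f : {additive A -> 'rV['F_p]_n}) :
  bijective f -> \dim (fullv : {vspace A}) = n.
Proof.
move=> [g fK gK].
pose fS := GRing.isScalable.Build _ _ _ _ f (@additive_Fp_linear p A _ f).
pose fL : {linear A -> 'rV_n} := HB.pack (f : A -> 'rV_n) f fS.
have fE a : linfun fL a = f a by rewrite lfunE.
have kerf : lker (linfun fL) == 0%VS.
  by apply/lker0P=> a b; rewrite !fE => /(can_inj fK).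
rewrite -(limg_dim_eq (f := linfun fL)) ?(eqP kerf) ?capv0 //.
suff -> : limg (linfun fL) = fullv by rewrite dimvf /dim /= mul1n.
apply/eqP; rewrite eqEsubv subvf; apply/subvP=> w _.
by rewrite -[w]gK -fE memv_img ?memvf.
Qed.

(** * Five-dimensional algebras with four generators *)

Theorem theorem7p0p2 (p : nat) (p_prime : prime p)
    (A : vectType 'F_p) (mul : {bilinear A -> A -> A})
    (A_prelie : pre_lie mul) (A_nilp : nilpotent_alg mul)
    (A_iso : exists f : {additive A -> 'rV['F_p]_5}, bijective f)
    (x y z u : A)
    (A_gen : generates mul [:: x; y; z; u])
    (A_gen_min : forall s : seq A, generates mul s -> (4 <= size s)%N) :
  let X := [:: x; y; z; u] in
  let S'' := [seq mul i j | i <- X, j <- X] in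
  [/\ dseries mul 2 <> 0%VS /\ dseries mul 3 = 0%VS,
      exists2 v, v \in S'' & v <> 0
    & forall v, v \in S'' -> v <> 0 ->
        basis_of fullv [:: x; y; z; u; v] /\
        exists alpha : A -> A -> 'F_p,
          (forall i j, i \in X -> j \in X -> mul i j = alpha i j *: v) /\
          (exists i j, [/\ i \in X, j \in X & alpha i j <> 0])].
Proof.
move=> X S''; have [f f_bij] := A_iso.
have dimA := additive_bij_dim f_bij.
have genA := generates_span A_gen.
have dimA2 : (\dim (dseries mul 2) <= 1)%N.
  by have := min_generators_dim A_nilp A_gen_min; rewrite dimA.
have A2_neq0 : dseries mul 2 <> 0%VS.
  move=> A2_0; have := dim_span X.
  by move: genA; rewrite A2_0 addv0 -/X => ->; rewrite dimA.
have A3_0 : dseries mul 3 = 0%VS.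
  apply/eqP; rewrite -dimv_eq0 -leqn0 -ltnS; apply: leq_trans dimA2.
  rewrite ltnNge; apply/negP=> leA23; apply/A2_neq0/(dseries2_stable A_nilp).
  have := dimv_leqif_eq (dseries3_sub2 mul).
  by move=> /geq_leqif; rewrite leA23 => /esym/eqP->.
split=> // [|v Sv v_neq0].
  have [/hasP[v Sv /eqP v_neq0] | /hasPn S0] := boolP (has (predC1 0) S'').
    by exists v.
  case: A2_neq0; apply/eqP; rewrite -subv0.
  apply: subv_trans (dseries2_gen A_gen) _; rewrite A3_0 addv0.
  by apply/span_subvP=> w /S0; rewrite /= negbK => /eqP->; apply: mem0v.
have SA2 w : w \in S'' -> w \in dseries mul 2.
  by case/allpairsP=> -[i j] [_ _ ->]; apply: mem_mul_dseries2.
have A2E : dseries mul 2 = <<[:: v]>>%VS.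
  apply/esym/eqP; rewrite eqEdim span_seq1 -memvE SA2 //= dim_vline.
  by rewrite (introN eqP v_neq0).
split.
  rewrite basisEdim dimA andbT -[[:: x; y; z; u; v]]/(X ++ [:: v]).
  by rewrite span_cat -A2E genA.
pose alpha i j := coord [tuple v] ord0 (mul i j).
have alphaE i j : mul i j = alpha i j *: v.
  have : mul i j \in <<[tuple v]>>%VS by rewrite -A2E mem_mul_dseries2.
  by move/coord_span; rewrite big_ord1.
exists alpha; split=> [i j _ _|]; first exact: alphaE.
case/allpairsP: Sv => -[i j] /= [Xi Xj v_ij]; exists i, j; split=> // alpha0.
by apply: v_neq0; rewrite v_ij alphaE alpha0 scale0r.
Qed.
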